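(* Let $n\ge3$ and $r\ge1$ be integers. The matrix $K_{n,r}$ is irreducible.
   Context: For integers $n\ge3$ and $r\ge1$, the digraph $\Gamma_{n,r}$ has vertex set $V(\Gamma_{n,r})=\{1,2,\dots,rn-2r+2\}$ and directed edge set $E(\Gamma_{n,r})$ defined by $E(\Gamma_{n,1})=\{(j,j+1):1\le j\le n-1\}\cup\{(n,1)\}$; $E(\Gamma_{n,2})=E(\Gamma_{n,1})\cup\{(1,n+1)\}\cup\{(j,j+1):n+1\le j\le 2n-3\}\cup\{(2n-2,n)\}$; and for $r\ge3$, $E(\Gamma_{n,r})=E(\Gamma_{n,2})\cup\bigcup_{i=1}^{r-2}F_i$, where $F_i=\{(in-2i+2,\,in+n-2i+1)\}\cup\{(j,j+1):in+n-2i+1\le j\le in+2n-2i-3\}\cup\{(in+2n-2i-2,\,in+n-2i)\}$. (For $n=3$ the middle path parts are empty.) Layers: define $\ell:V(\Gamma_{n,r})\to\mathbb Z/n\mathbb Z$ along this recursive construction (edges being added in the order in which they are listed above) by $\ell(1)=0$ and, whenever a vertex $v\ne1$ appears for the first time as the terminal vertex of a newly added edge $(u,v)$, $\ell(v)\equiv\ell(u)+1 \pmod n$. For $c\in\mathbb Z/n\mathbb Z$ set $V^{(c)}_{n,r}=\{v:\ell(v)\equiv c \pmod n\}$. Every edge goes from some $V^{(c)}_{n,r}$ to $V^{(c+1)}_{n,r}$ (indices mod $n$). Let $B_{n,r}^{(c)}$ be the $(0,1)$-matrix with rows indexed by $V^{(c)}_{n,r}$ and columns by $V^{(c+1)}_{n,r}$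 (each in increasing order, indices mod $n$), with $(u,v)$-entry $1$ if and only if $(u,v)\in E(\Gamma_{n,r})$. The cyclic product core is the square matrix $K_{n,r}=B_{n,r}^{(0)}B_{n,r}^{(1)}\cdots B_{n,r}^{(n-1)}$, indexed by $V^{(0)}_{n,r}$. A square matrix is irreducible if it cannot be transformed into block upper triangular form by a simultaneous permutation of rows and columns. *)

(* Defs.v *)
From mathcomp Require Import all_boot all_fingroup all_algebra.

Set Implicit Arguments.
Unset Strict Implicit.
Unset Printing Implicit Defensive.

Import GRing.Theory.

Definition vertices (n r : nat) : seq nat := iota 1 (r * n - 2 * r + 2).

(* The edges (j, j+1) for a <= j <= b; empty when b < a. *)
Definition path_edges (a b : nat) : seq (nat * nat) :=
  [seq (j, j.+1) | j <- index_iota a b.+1].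

Definition edges1 (n : nat) : seq (nat * nat) :=
  path_edges 1 (n - 1) ++ [:: (n, 1)].

Definition edges2 (n : nat) : seq (nat * nat) :=
  [:: (1, n + 1)] ++ path_edges (n + 1) (2 * n - 3) ++ [:: (2 * n - 2, n)].

Definition edgesF (n i : nat) : seq (nat * nat) :=
  [:: (i * n - 2 * i + 2, i * n + n - 2 * i + 1)]
  ++ path_edges (i * n + n - 2 * i + 1) (i * n + 2 * n - 2 * i - 3)
  ++ [:: (i * n + 2 * n - 2 * i - 2, i * n + n - 2 * i)].

(* The edge set, listed in the order of the recursive construction; all the
   truncated subtractions above are exact when 3 <= n and 1 <= i. *)
Definition edges (n r : nat) : seq (nat * nat) :=
  edges1 n ++ (if 2 <= r then edges2 n else [::])
  ++ flatten [seq edgesF n i | i <- iota 1 (r - 2)].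

(* Adds the edges of es one by one. The list seen holds the vertices whose
   layer is already fixed; layers are represented by their residue modulo n. *)
Fixpoint assign_layers (n : nat) (es : seq (nat * nat)) (seen : seq nat)
    (l : nat -> nat) : nat -> nat :=
  if es is (u, v) :: es' then
    if v \in seen then assign_layers n es' seen l
    else assign_layers n es' (v :: seen)
           (fun w => if w == v then (l u).+1 %% n else l w)
  else l.

(* The initial value 0 only matters at vertex 1: every other vertex is
   overwritten when it is first reached. *)
Definition layer (n r : nat) : nat -> nat :=
  assign_layers n (edges n r) [:: 1] (fun _ => 0).

(* The vertices of layer c modulo n, in increasing order. *)
Definition layer_class (n r c : nat) : seq nat :=
  [seq v <- vertices n r | layer n r v == c %[mod n]].

Definition layer_mx (n r c : nat) :
    'M[int]_(size (layer_class n r c), size (layer_class n r c.+1)) :=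
  \matrix_(i, j)
    ((nth 0 (layer_class n r c) i, nth 0 (layer_class n r c.+1) j)
       \in edges n r)%:R%R.

Fixpoint layer_mx_prod (n r k : nat) :
    'M[int]_(size (layer_class n r 0), size (layer_class n r k)) :=
  if k is k'.+1 then (layer_mx_prod n r k' *m layer_mx n r k')%R
  else (1%:M)%R.

Lemma layer_class_n (n r : nat) : layer_class n r n = layer_class n r 0.
Proof. by apply: eq_filter => v; rewrite modnn mod0n. Qed.

(* layer_class n r n and layer_class n r 0 are the same list, so the cast
   only adjusts the type of the column index. *)
Definition cyclic_product_core (n r : nat) :
    'M[int]_(size (layer_class n r 0)) :=
  castmx (erefl, congr1 size (layer_class_n n r)) (layer_mx_prod n r n).

Definition irreducible_mx (R : pzSemiRingType) (m : nat) (A : 'M[R]_m) : Prop :=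
  ~ exists (p q : nat) (e : m = p + q) (s : 'S_m)
      (B : 'M[R]_p) (C : 'M[R]_(p, q)) (D : 'M[R]_q),
      [/\ 0 < p, 0 < q &
          castmx (e, e) (row_perm s (col_perm s A)) = block_mx B C 0%R D].

(* Main.v *)
Require Import Defs.
From mathcomp Require Import all_boot all_order all_fingroup all_algebra.
From mathcomp Require Import zify.

Set Implicit Arguments.
Unset Strict Implicit.
Unset Printing Implicit Defensive.

Import Order.TTheory GRing.Theory Num.Theory.

(** The digraph is strongly connected and every edge raises the layer by exactly
    one modulo n; these two facts force irreducibility of the cyclic product
    core K.

    The (u, v) entry of K counts the walks of length n from u to v, so it is
    positive as soon as one such walk exists ([layer_mx_prod_gt0]).  A walk
    between two vertices of layer 0 has length divisible by n, and each of its
    consecutive pieces of length n ends in layer 0 again.  A set of indices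
    that is closed under the nonzero entries of K therefore contains every
    vertex of layer 0 that a walk reaches from it; by strong connectivity it is
    empty or everything, whereas a block triangular form would exhibit a proper
    nonempty closed set ([irreducible_mx_closed]).

    Both facts come from an ear decomposition.  Put m = n - 2.  The construction
    starts with the cycle 1, ..., m + 2 and then attaches, for k = 1, ...,
    r - 1, an ear through the m new vertices km + 3, ..., (k + 1)m + 2, which
    leaves from an old vertex and returns to the old vertex km + 2.  Attaching
    an ear to a strongly connected digraph keeps it strongly connected
    ([ears_strongly_connected]).  For the layers, an explicit function [level]
    rises by one modulo n along every ear, the return edge included
    ([level_ears]).  Since the recursive rule reads the layer of a new vertex
    off one incoming edge, it computes [level] modulo n ([assign_layersE]), so
    the layers are compatible with all the edges. *)

(** * Irreducibility and closed index sets *)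

(** In the form [[B, C], [0, D]] the images under s of the last q indices
    form a closed set; it is nonempty because 0 < q and misses an
    index because 0 < p. *)
Lemma irreducible_mx_closed (R : pzSemiRingType) (m : nat) (A : 'M[R]_m) :
  (forall S : pred 'I_m,
     (forall i j, S i -> A i j != 0%R -> S j) ->
     forall i j, S i -> S j) ->
  irreducible_mx A.
Proof.
move=> clA [p [q [e [s [B [C [D [p0 q0]]]]]]]]; subst m.
rewrite castmx_id => /matrixP eA.
pose S : pred 'I_(p + q) := fun x => p <= s^-1%g x.
have clS i j : S i -> A i j != 0%R -> S j.
  rewrite /S => Si; apply: contraR; rewrite -ltnNge => Sj.
  have q_i : s^-1%g i - p < q by have := ltn_ord (s^-1%g i); lia.
  have := eA (rshift p (Ordinal q_i)) (lshift q (Ordinal Sj)).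
  rewrite block_mxEdl !mxE.
  have -> : rshift p (Ordinal q_i) = s^-1%g i by apply: val_inj => /=; lia.
  have -> : lshift q (Ordinal Sj) = s^-1%g j by apply: val_inj.
  by rewrite !permKV => ->.
have := clA S clS (s (rshift p (Ordinal q0))) (s (lshift q (Ordinal p0))).
by rewrite /S !permK /= leq_addr leqNgt p0 => /(_ isT).
Qed.

(** * Ear decompositions *)

(** A pair (a, p) stands for the walk that starts at a and then visits the
    vertices of p; an ear is such a walk with both ends among earlier
    vertices. *)
Definition walk_edges (ear : nat * seq nat) : seq (nat * nat) :=
  pairmap pair ear.1 ear.2.

Definition ear_edges (ears : seq (nat * seq nat)) : seq (nat * nat) :=
  flatten [seq walk_edges ear | ear <- ears].

Definition ear_vertices (ears : seq (nat * seq nat)) : seq nat :=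
  flatten [seq ear.2 | ear <- ears].

Fixpoint ears_on (seen : seq nat) (ears : seq (nat * seq nat)) : bool :=
  if ears is ear :: ears' then
    [&& ear.1 \in seen, last ear.1 ear.2 \in seen
      & ears_on (seen ++ ear.2) ears']
  else true.

Lemma all_walk_edges (P : rel nat) a p :
  all (fun uv => P uv.1 uv.2) (walk_edges (a, p)) = path P a p.
Proof. by rewrite /walk_edges /=; elim: p a => //= b p IHp a; rewrite IHp. Qed.

Lemma walk_edges_targets a p : unzip2 (walk_edges (a, p)) = p.
Proof. by rewrite /walk_edges /=; elim: p a => //= b p IHp a; rewrite IHp. Qed.

Lemma ear_edges_targets ears : unzip2 (ear_edges ears) = ear_vertices ears.
Proof.
elim: ears => //= -[a p] ears IH.
by rewrite [LHS]map_cat [X in X ++ _]walk_edges_targets; congr (_ ++ _).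
Qed.

Definition reachable (e : rel nat) (u v : nat) : Prop :=
  exists2 p, path e u p & last u p = v.

Lemma reachable_trans e u v w :
  reachable e u v -> reachable e v w -> reachable e u w.
Proof.
move=> [p pp <-] [q pq <-]; exists (p ++ q); last by rewrite last_cat.
by rewrite cat_path pp.
Qed.

Lemma path_reachable e a p x :
  path e a p -> x \in p -> reachable e a x /\ reachable e x (last a p).
Proof.
move=> + /splitPr xp; case: xp => p1 p2.
rewrite cat_path last_cat /= => /and3P[pp1 ex pp2]; split; last by exists p2.
by exists (rcons p1 x); rewrite ?last_rcons // rcons_path pp1.
Qed.

(** A vertex on a new ear is reached from the start of the ear, and reaches its
    end; both of these are old vertices, which are connected to the root. *)
Lemma ears_strongly_connected (e : rel nat) (root : nat) seen ears :
  ears_on seen ears ->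
  {in ear_edges ears, forall uv, e uv.1 uv.2} ->
  {in seen, forall v, reachable e root v /\ reachable e v root} ->
  {in seen ++ ear_vertices ears,
     forall v, reachable e root v /\ reachable e v root}.
Proof.
elim: ears seen => [|[a p] ears IH] seen /=; first by rewrite cats0.
move=> /and3P[a_seen z_seen ears_ok] e_ok seen_ok v.
rewrite /ear_vertices /= catA; apply: IH v => // [uv uvP|].
  by apply: e_ok; rewrite /ear_edges /= mem_cat uvP orbT.
have pp : path e a p.
  rewrite -all_walk_edges; apply/allP => uv uvP.
  by apply: e_ok; rewrite /ear_edges /= mem_cat uvP.
move=> v; rewrite mem_cat => /orP[/seen_ok //|v_p].
have [av vz] := path_reachable pp v_p; split.
  exact: reachable_trans (seen_ok _ a_seen).1 av.
exact: reachable_trans vz (seen_ok _ z_seen).2.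
Qed.

(** * Layers *)

(** The order condition under which the recursive layer rule is meaningful:
    the source of each edge has been met before the edge is added. *)
Fixpoint sourced (seen : seq nat) (es : seq (nat * nat)) : bool :=
  if es is (u, v) :: es' then (u \in seen) && sourced (v :: seen) es' else true.

Lemma ears_sourced seen seen' ears :
  {subset seen <= seen'} -> ears_on seen ears -> sourced seen' (ear_edges ears).
Proof.
elim: ears seen seen' => //= -[a p] ears IH seen seen' sub.
rewrite /ear_edges /walk_edges /= => /and3P[/sub a_seen _ /IH ears_ok].
have {}ears_ok : forall S, {subset seen' <= S} -> {subset p <= S} ->
    sourced S (ear_edges ears).
  move=> S sS pS; apply: ears_ok => x; rewrite mem_cat.
  by case/orP => [/sub/sS|/pS].
elim: p a seen' a_seen {sub} ears_ok => [|b p IHp] a seen' a_seen ears_ok /=.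
  exact: ears_ok.
rewrite a_seen; apply: IHp; first exact: mem_head.
move=> S sS pS; apply: ears_ok => x.
  by move=> xs; apply: sS; rewrite inE xs orbT.
by rewrite inE => /predU1P[->|/pS //]; apply: sS; exact: mem_head.
Qed.

(** Potentials determine the layers: if f rises by one modulo n along every
    edge, then each newly layered vertex receives the residue of its value of
    f.  The list S, which may repeat vertices that [seen] skips, is kept apart
    from [seen] so that [sourced] can be consumed edge by edge. *)
Lemma assign_layersE n (f : nat -> nat) es S seen l :
  {subset S <= seen} -> sourced S es ->
  {in es, forall uv, f uv.2 = (f uv.1).+1 %[mod n]} ->
  {in seen, forall w, l w = f w %[mod n]} ->
  {in S ++ unzip2 es, forall w, assign_layers n es seen l w = f w %[mod n]}.
Proof.
have catE S' (v : nat) vs x :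
  x \in S' ++ v :: vs = (x \in (v :: S') ++ vs).
  by rewrite !(mem_cat, inE) orbCA orbA.
elim: es S seen l => [|[u v] es IH] S seen l /= sub.
  by move=> _ _ l_ok w; rewrite cats0 => /sub/l_ok.
move=> /andP[u_S src] f_ok l_ok w; rewrite catE => w_in.
have es_ok : {in es, forall uv, f uv.2 = (f uv.1).+1 %[mod n]}.
  by move=> uv uvP; apply: f_ok; rewrite inE uvP orbT.
case: ifPn => v_seen; apply: (IH (v :: S)) => //.
- by move=> x; rewrite inE => /predU1P[->|/sub].
- by move=> x; rewrite !inE => /orP[->//|/sub->]; rewrite orbT.
move=> x; rewrite inE /=; case: eqP => [-> _|_ /= /l_ok //].
have /= := f_ok (u, v) (mem_head _ _) => ->.
by rewrite modn_mod -(addn1 (l u)) -(addn1 (f u)) -modnDml (l_ok _ (sub _ u_S))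
  modnDml.
Qed.

(** * The ears of the digraph *)

(** The first block ear leaves from the vertex 1, whereas the general formula
    would give 2. *)
Definition ear_source (m k : nat) : nat :=
  if k == 1 then 1 else k.-1 * m + 2.

Definition block_ear (m k : nat) : nat * seq nat :=
  (ear_source m k, rcons (iota (k * m + 3) m) (k * m + 2)).

(** Here m = n - 2 and t = r - 1.  The initial cycle counts as an ear attached
    at both ends to the vertex 1. *)
Definition ears (m t : nat) : seq (nat * seq nat) :=
  (1, rcons (iota 2 m.+1) 1) :: [seq block_ear m k | k <- iota 1 t].

Lemma path_edges_walk a b d :
  a <= b.+1 ->
  path_edges a b ++ [:: (b.+1, d)]
    = walk_edges (a, rcons (iota a.+1 (b.+1 - a)) d).
Proof.
rewrite /path_edges /walk_edges /index_iota /= => ab.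
rewrite -{2}(subnKC ab); move: (b.+1 - a) => k {b ab}.
elim: k a => [|k IH] a; first by rewrite addn0.
by rewrite /= addnS -addSn IH.
Qed.

Lemma block_ear_edges m k a b :
  0 < m -> a = ear_source m k -> b = k * m + 2 ->
  [:: (a, b.+1)] ++ path_edges b.+1 (b + m.-1) ++ [:: (b + m, b)]
    = walk_edges (block_ear m k).
Proof.
case: m => // m _ -> ->; rewrite [_ + m.+1]addnS /=.
rewrite path_edges_walk; last lia.
rewrite /block_ear /walk_edges /= addnS.
by congr ((_, _) :: pairmap _ _ (rcons (iota _ _) _)); lia.
Qed.

Lemma edges_ears m t : 0 < m -> edges m.+2 t.+1 = ear_edges (ears m t).
Proof.
move=> m0; rewrite -[RHS]/(walk_edges (1, rcons (iota 2 m.+1) 1)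
  ++ ear_edges [seq block_ear m k | k <- iota 1 t]).
rewrite /edges; congr (_ ++ _).
  by rewrite /edges1 subSS subn0 (path_edges_walk 1).
case: t => [|t] //; rewrite -[RHS]/(walk_edges (block_ear m 1)
  ++ ear_edges [seq block_ear m k | k <- iota 2 t]).
congr (_ ++ _).
  rewrite -(block_ear_edges (a := 1) (b := m.+2) m0) //; last lia.
  by congr ([:: (_, _)] ++ path_edges _ _ ++ [:: (_, _)]); lia.
rewrite /ear_edges -map_comp; congr flatten; rewrite !subSS subn0.
rewrite (iotaDl 1 1) -map_comp; apply/eq_in_map => k.
rewrite mem_iota => /andP[k1 _] /=.
rewrite -(block_ear_edges (a := k * m + 2) (b := k.+1 * m + 2) m0) //;
  last by case: k k1.
by congr ([:: (_, _)] ++ path_edges _ _ ++ [:: (_, _)]); nia.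
Qed.

Lemma ears_rcons m t : ears m t.+1 = rcons (ears m t) (block_ear m t.+1).
Proof.
rewrite /ears -{1}(addn1 t) iotaD map_cat rcons_cons; congr (_ :: _).
exact: cats1.
Qed.

Lemma ear_vertices_rcons es ear :
  ear_vertices (rcons es ear) = ear_vertices es ++ ear.2.
Proof. by rewrite /ear_vertices map_rcons flatten_rcons. Qed.

Lemma ears_on_rcons seen es ear :
  ears_on seen (rcons es ear) =
    [&& ears_on seen es, ear.1 \in seen ++ ear_vertices es
      & last ear.1 ear.2 \in seen ++ ear_vertices es].
Proof.
elim: es seen => [|ear' es IH] seen /=; first by rewrite cats0 andbT.
by rewrite IH /ear_vertices /= catA -!andbA.
Qed.

Lemma mem_vertices m t v :
  (v \in vertices m.+2 t.+1) = (0 < v <= t.+1 * m + 2).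
Proof. by rewrite mem_iota; nia. Qed.

Lemma ear_verticesE m t :
  [:: 1] ++ ear_vertices (ears m t) =i vertices m.+2 t.+1.
Proof.
move=> v; rewrite mem_vertices.
elim: t => [|t IH].
  by rewrite /ear_vertices /= cats0 !(inE, mem_rcons, mem_iota); lia.
rewrite ears_rcons ear_vertices_rcons catA mem_cat IH /= mem_rcons inE mem_iota.
lia.
Qed.

Lemma ears_onP m t : ears_on [:: 1] (ears m t).
Proof.
elim: t => [|t IH]; first by rewrite /= last_rcons !inE.
rewrite ears_rcons ears_on_rcons IH /= last_rcons !ear_verticesE.
by rewrite !mem_vertices /ear_source; case: eqP => _; lia.
Qed.

(** Along the k-th block the layers are those of block 0 shifted by -k.  As
    m + 1 is -1 modulo m + 2, adding k (m + 1) realizes this shift inside the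
    natural numbers. *)
Definition level (m v : nat) : nat :=
  if v < 3 then v.-1 else (v - 3) %% m + 2 + (v - 3) %/ m * m.+1.

Lemma level_block m k j : j < m -> level m (k * m + 3 + j) = j + 2 + k * m.+1.
Proof.
move=> jm; rewrite /level ifN; last lia.
rewrite (_ : _ - 3 = k * m + j); last lia.
by rewrite modnMDl divnMDl ?modn_small ?divn_small ?addn0 //; lia.
Qed.

Lemma level_first m v : 0 < v <= m + 2 -> level m v = v.-1.
Proof.
move=> v_le; case: (ltnP v 3) => [v3|v3]; first by rewrite /level v3.
by rewrite (_ : v = 0 * m + 3 + (v - 3)) ?level_block; lia.
Qed.

Lemma path_iota (e : rel nat) a b k d :
  e a b -> (forall j, j < k -> e (b + j) (b + j.+1)) -> e (b + k) d ->
  path e a (rcons (iota b k.+1) d).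
Proof.
elim: k a b => [|k IH] a b eab ej ed /=; first by rewrite eab -[b]addn0 ed.
rewrite eab; apply: IH; first by rewrite -addn1 -[X in e X _]addn0 ej.
- by move=> j jk; rewrite !addSnnS; apply: ej.
- by rewrite addSnnS.
Qed.

(** Inside each block [level] rises by exactly one.  On the return edges, and on
    the edges that enter a block ear, the rise is one only after a correction
    by m + 2, which is where the attachment vertices of the ears matter. *)
Lemma level_ears m t : 0 < m ->
  {in ear_edges (ears m t),
     forall uv, level m uv.2 = (level m uv.1).+1 %[mod m.+2]}.
Proof.
move=> m0 uv.
pose e : rel nat := fun u v => level m v == (level m u).+1 %[mod m.+2].
move=> /flatten_mapP[[a p] ear_in]; suff : path e a p.
  by rewrite -all_walk_edges => /allP e_ok /e_ok/eqP.
move: ear_in; rewrite inE => /predU1P[[-> ->]|].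
  apply: path_iota => [|j jm|]; rewrite /e !level_first //; try lia.
  by rewrite (_ : (2 + m).-1.+1 = m.+2) ?modnn ?mod0n //; lia.
case/mapP => k; rewrite mem_iota => /andP[k0 _] [-> ->].
have last_lvl i : level m (i.+1 * m + 2) = i.+1 * m.+1.
  by rewrite (_ : _ + 2 = i * m + 3 + m.-1) ?level_block; lia.
case: m m0 @e last_lvl => // m _ e last_lvl.
apply: path_iota => [|j jm|].
- rewrite /e -[k * _ + 3]addn0 level_block // /ear_source.
  case: k k0 => [//|[|k] _] /=.
    by rewrite level_first // (_ : 0 + 2 + _ = 1 + m.+3) ?modnDr //; lia.
  by rewrite last_lvl (_ : 0 + 2 + _ = (k.+1 * m.+2).+1 + m.+3) ?modnDr //; lia.
- by rewrite /e !level_block //; lia.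
rewrite /e level_block //; case: k k0 => // k _; rewrite last_lvl.
by rewrite (_ : (_ + _).+1 = k.+1 * m.+2 + m.+3) ?modnDr //; lia.
Qed.

(** * Walks and the cyclic product core *)

Definition edge (n r : nat) : rel nat := fun u v => (u, v) \in edges n r.

Lemma layerE m t : 0 < m ->
  {in vertices m.+2 t.+1,
     forall v, layer m.+2 t.+1 v = level m v %[mod m.+2]}.
Proof.
move=> m0 v vV; rewrite /layer edges_ears //.
apply: (assign_layersE (S := [:: 1])) => //.
- exact: ears_sourced (ears_onP m t).
- exact: level_ears.
- by move=> w; rewrite inE => /eqP->.
- by rewrite ear_edges_targets ear_verticesE.
Qed.

Lemma edge_layer m t u v : 0 < m ->
  u \in vertices m.+2 t.+1 -> edge m.+2 t.+1 u v ->
  v \in vertices m.+2 t.+1 /\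
  layer m.+2 t.+1 v = (layer m.+2 t.+1 u).+1 %[mod m.+2].
Proof.
move=> m0 uV; rewrite /edge edges_ears // => uv.
have vV : v \in vertices m.+2 t.+1.
  rewrite -ear_verticesE mem_cat -ear_edges_targets.
  by apply/orP; right; apply/mapP; exists (u, v).
split=> //; rewrite layerE // (level_ears m0 uv) /=.
by rewrite -addn1 -modnDml -(layerE m0 uV) modnDml addn1.
Qed.

Lemma path_layer_class m t u c p : 0 < m ->
  u \in layer_class m.+2 t.+1 c -> path (edge m.+2 t.+1) u p ->
  last u p \in layer_class m.+2 t.+1 (c + size p).
Proof.
move=> m0; elim: p u c => [|v p IH] u c /=; first by rewrite addn0.
rewrite mem_filter => /andP[/eqP u_c uV] /andP[uv pp].
have [vV v_l] := edge_layer m0 uV uv.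
rewrite -addSnnS; apply: IH pp; rewrite mem_filter vV andbT v_l.
by rewrite -addn1 -modnDml u_c modnDml addn1.
Qed.

Lemma vertices_reachable m t u v : 0 < m ->
  u \in vertices m.+2 t.+1 -> v \in vertices m.+2 t.+1 ->
  reachable (edge m.+2 t.+1) u v.
Proof.
move=> m0; pose e := edge m.+2 t.+1.
have conn : {in [:: 1] ++ ear_vertices (ears m t), forall w,
    reachable e 1 w /\ reachable e w 1}.
  apply: ears_strongly_connected (ears_onP m t) _ _ => [[x y]|w].
    by rewrite /e /edge edges_ears.
  by rewrite inE => /eqP->; split; exists [::].
rewrite -!ear_verticesE => /conn[_ u1] /conn[v1 _].
exact: reachable_trans u1 v1.
Qed.

Lemma layer_mx_prod_ge0 n r k i j : (0 <= layer_mx_prod n r k i j)%R.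
Proof.
elim: k j => [|k IH] j; first by rewrite mxE; case: eqP.
rewrite mxE; apply: sumr_ge0 => x _; apply: mulr_ge0; first exact: IH.
by rewrite mxE ler0n.
Qed.

(** The walk p contributes one positive term to the matrix product, and no
    cancellation can occur since all the other terms are nonnegative. *)
Lemma layer_mx_prod_gt0 m t (m0 : 0 < m) k
    (i : 'I_(size (layer_class m.+2 t.+1 0)))
    (j : 'I_(size (layer_class m.+2 t.+1 k))) p :
  path (edge m.+2 t.+1) (nth 0 (layer_class m.+2 t.+1 0) i) p ->
  size p = k ->
  last (nth 0 (layer_class m.+2 t.+1 0) i) p
    = nth 0 (layer_class m.+2 t.+1 k) j ->
  (0 < layer_mx_prod m.+2 t.+1 k i j)%R.
Proof.
have i_in : nth 0 (layer_class m.+2 t.+1 0) i \in layer_class m.+2 t.+1 0.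
  exact: mem_nth.
elim: k j p => [|k IH] j p.
  move=> _ /size0nil -> /= /eqP.
  rewrite nth_uniq ?filter_uniq ?iota_uniq // => /eqP/val_inj->.
  by rewrite mxE eqxx.
case/lastP: p => // p v; rewrite rcons_path size_rcons last_rcons.
move=> /andP[pp ev] [sz] v_j.
have w_in := path_layer_class m0 i_in pp; rewrite add0n sz in w_in.
have w_lt := w_in; rewrite -index_mem in w_lt.
rewrite mxE (bigD1 (Ordinal w_lt)) //=; apply: ltr_wpDr.
  apply: sumr_ge0 => x _; rewrite mulr_ge0 ?layer_mx_prod_ge0 //.
  by rewrite mxE ler0n.
apply: mulr_gt0; first by apply: (IH _ p) => //=; rewrite nth_index.
by rewrite mxE /= nth_index // -v_j [_ \in _]ev.
Qed.

Theorem proposition3p3 (n r : nat) (hn : 3 <= n) (hr : 1 <= r) :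
  irreducible_mx (cyclic_product_core n r).
Proof.
case: n hn => [|[|m]] // hm; case: r hr => // t _.
have {hm} m0 : 0 < m by [].
set n := m.+2; set r := t.+1.
apply: irreducible_mx_closed => S clS i j Si.
pose vx (x : 'I_(size (layer_class n r 0))) := nth 0 (layer_class n r 0) x.
have vx_in x : vx x \in layer_class n r 0 by exact: mem_nth.
have vx_V x : vx x \in vertices n r.
  by have := vx_in x; rewrite mem_filter => /andP[].
have [p pp pj] := vertices_reachable m0 (vx_V i) (vx_V j).
have [N] := ubnP (size p).
elim: N i Si p pp pj => // N IH i Si p pp pj /ltnSE sz_p.
(* A walk from layer 0 to layer 0 of length less than n is trivial. *)
have [p_n|p_n] := ltnP (size p) n.
  have := path_layer_class m0 (vx_in i) pp; rewrite add0n pj mem_filter.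
  have := vx_in j; rewrite mem_filter => /andP[/eqP-> _] /andP[/eqP + _].
  rewrite mod0n modn_small // => /esym/size0nil p0.
  move: pj; rewrite p0 /= => /eqP.
  by rewrite nth_uniq ?filter_uniq ?iota_uniq // => /eqP/val_inj<-.
(* Otherwise its first n steps realize a nonzero entry of the core. *)
move: pp pj; rewrite -(cat_take_drop n p) cat_path last_cat.
move=> /andP[pp1 pp2] pj.
have sz1 : size (take n p) = n by rewrite size_takel.
have w_in := path_layer_class m0 (vx_in i) pp1.
rewrite add0n sz1 layer_class_n in w_in.
have w_lt := w_in; rewrite -index_mem in w_lt.
have vx_w : vx (Ordinal w_lt) = last (vx i) (take n p) by rewrite /vx nth_index.
apply: (IH (Ordinal w_lt) _ (drop n p)); rewrite ?vx_w //; last first.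
  by rewrite size_drop; lia.
apply: clS Si _; rewrite /cyclic_product_core castmxE gt_eqF //.
apply: (layer_mx_prod_gt0 m0 (p := take n p)) => //=.
by rewrite layer_class_n nth_index.
Qed.
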